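(* Let $\mathfrak{D}_n$ denote the set of desarrangements of length $n$, and for a permutation statistic $\mathrm{st}$ let $D^{\mathrm{st}}(t,x)=\sum_{n\ge 0}\sum_{\pi\in\mathfrak{D}_n}t^{\mathrm{st}(\pi)}\frac{x^n}{n!}$. Then \[ \text{(a)}\quad D^{\mathrm{pk}}(t,x)=1-t^{-1}+\frac{t^{-1}e^{-x}\sqrt{1-t}}{\sqrt{1-t}\cosh\left(x\sqrt{1-t}\right)-\sinh\left(x\sqrt{1-t}\right)} \] and \[ \text{(b)}\quad D^{\mathrm{val}}(t,x)=\frac{e^{-x}\sqrt{1-t}}{\sqrt{1-t}-\tanh(x\sqrt{1-t})}. \]
   Context: Permutations $\pi\in\mathfrak{S}_n$ are written in one-line notation $\pi=\pi_1\cdots\pi_n$; $\mathfrak{S}_0$ consists of the empty permutation. An index $i\in[n-1]$ is a descent of $\pi$ if $\pi_i>\pi_{i+1}$; $i\in[n]$ is an ascent if it is not a descent (so $n$ is always an ascent). A desarrangement is a permutation whose first ascent is even; the empty permutation is a desarrangement. For $i\in\{2,\dots,n-1\}$, $i$ is a peak of $\pi$ if $\pi_{i-1}<\pi_i>\pi_{i+1}$ and a valley if $\pi_{i-1}>\pi_i<\pi_{i+1}$; $\mathrm{pk}(\pi)$ and $\mathrm{val}(\pi)$ denote the numbers of peaks and valleys. The right-hand sides are interpreted as formal power series in $x$ (they are even functions of $\sqrt{1-t}$, hence have coefficients in $\mathbb{Q}(t)$). *)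

(* Defs.v *)
From HB Require Import structures.
From mathcomp Require Import all_boot all_order all_algebra all_fingroup.
From mathcomp Require Import boolp.

Set Implicit Arguments.
Unset Strict Implicit.
Unset Printing Implicit Defensive.

Import GRing.Theory.
Local Open Scope ring_scope.

(* Formal power series: [f n] is the coefficient of x^n. *)
Record fps (R : Type) := Fps { fps_coef :> nat -> R }.

Section FpsType.
Variable R : Type.

Lemma fpsP (f g : fps R) : f =1 g <-> f = g.
Proof.
split=> [|-> //]; case: f g => f [g] /= fg.
by congr Fps; apply/funext.
Qed.

HB.instance Definition _ := gen_eqMixin (fps R).
HB.instance Definition _ := gen_choiceMixin (fps R).
End FpsType.

Section FpsZmod.
Variable R : zmodType.
Implicit Types f g h : fps R.

Definition addfps f g := Fps (fun n => f n + g n).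
Definition oppfps f := Fps (fun n => - f n).
Definition zerofps : fps R := Fps (fun=> 0).

Fact addfpsA : associative addfps.
Proof. by move=> f g h; apply/fpsP => n /=; rewrite addrA. Qed.
Fact addfpsC : commutative addfps.
Proof. by move=> f g; apply/fpsP => n /=; rewrite addrC. Qed.
Fact add0fps : left_id zerofps addfps.
Proof. by move=> f; apply/fpsP => n /=; rewrite add0r. Qed.
Fact addNfps : left_inverse zerofps oppfps addfps.
Proof. by move=> f; apply/fpsP => n /=; rewrite addNr. Qed.

HB.instance Definition _ :=
  GRing.isZmodule.Build (fps R) addfpsA addfpsC add0fps addNfps.
End FpsZmod.

Section FpsRing.
Variable R : comNzRingType.
Implicit Types f g h : fps R.

Definition mulfps f g := Fps (fun n => \sum_(i < n.+1) f i * g (n - i)%N).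
Definition constfps (a : R) := Fps (fun n => if n == 0%N then a else 0).
Definition onefps := constfps 1.

Definition truncfps (m : nat) f : {poly R} := \poly_(i < m) f i.

Lemma coef_mulfps m n f g : (n < m)%N ->
  mulfps f g n = (truncfps m f * truncfps m g)`_n.
Proof.
move=> nm; rewrite coefM /=; apply: eq_bigr => i _.
by rewrite !coef_poly (leq_ltn_trans (leq_ord i) nm)
           (leq_ltn_trans (leq_subr i n) nm).
Qed.

Fact mulfpsC : commutative mulfps.
Proof.
by move=> f g; apply/fpsP => n; rewrite !(@coef_mulfps n.+1) // mulrC.
Qed.

Fact mulfpsA : associative mulfps.
Proof.
move=> f g h; apply/fpsP => n; rewrite !(@coef_mulfps n.+1) //.
transitivity ((truncfps n.+1 f * (truncfps n.+1 g * truncfps n.+1 h))`_n).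
  rewrite !coefM; apply: eq_bigr => i _; congr (_ * _).
  rewrite coef_poly ltnS leq_subr.
  by rewrite (@coef_mulfps n.+1) // ltnS leq_subr.
rewrite mulrA !coefM; apply: eq_bigr => i _; congr (_ * _).
by rewrite coef_poly ltn_ord (@coef_mulfps n.+1).
Qed.

Fact mul1fps : left_id onefps mulfps.
Proof.
move=> f; apply/fpsP => n /=; rewrite big_ord_recl /= mul1r subn0.
by rewrite big1 ?addr0 // => i _; rewrite mul0r.
Qed.

Fact mulfpsDl : left_distributive mulfps +%R.
Proof.
move=> f g h; apply/fpsP => n /=; rewrite -big_split /=.
by apply: eq_bigr => i _; rewrite mulrDl.
Qed.

Fact onefps_neq0 : onefps != 0.
Proof. by apply/eqP => /fpsP/(_ 0%N) /= /eqP; rewrite oner_eq0. Qed.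

HB.instance Definition _ := GRing.Zmodule_isComNzRing.Build (fps R)
  mulfpsA mulfpsC mul1fps mulfpsDl onefps_neq0.
End FpsRing.

Section FpsUnitRing.
Variable R : comUnitRingType.
Implicit Types f g : fps R.

(* The first n coefficients of f^-1, by solving f * g = 1 degree by degree. *)
Fixpoint invfps_seq f n : seq R :=
  if n is m.+1 then
    let s := invfps_seq f m in
    rcons s ((f 0%N)^-1 * ((m == 0%N)%:R - \sum_(i < m) s`_i * f (m - i)%N))
  else [::].

Definition unitfps : {pred fps R} := fun f => f 0%N \is a GRing.unit.

Definition invfps f :=
  if unitfps f then Fps (fun n => (invfps_seq f n.+1)`_n) else f.

Lemma size_invfps_seq f n : size (invfps_seq f n) = n.
Proof. by elim: n => //= n IHn; rewrite size_rcons IHn. Qed.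

Lemma nth_invfps_seq f i n : (i < n)%N ->
  (invfps_seq f n)`_i = (invfps_seq f i.+1)`_i.
Proof.
elim: n => // n IHn; rewrite ltnS leq_eqVlt => /predU1P[-> //|lt_in].
by rewrite [LHS]nth_rcons size_invfps_seq lt_in IHn.
Qed.

Fact mulVfps : {in unitfps, left_inverse 1 invfps *%R}.
Proof.
move=> f; rewrite unfold_in => Uf; rewrite /invfps /unitfps Uf.
apply/fpsP => n; rewrite [LHS]big_ord_recr /= subnn.
rewrite nth_rcons size_invfps_seq ltnn eqxx mulrC mulrA divrr // mul1r.
under eq_bigr => i _ do
  rewrite -[nth _ (rcons _ _) _]/((invfps_seq f i.+1)`_i)
          -(@nth_invfps_seq f i n) //.
by rewrite addrC subrK; case: n.
Qed.

Fact unitfpsPl f g : g * f = 1 -> unitfps f.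
Proof.
move/fpsP/(_ 0%N); rewrite [LHS]big_ord_recl big_ord0 /= addr0 subnn => gf.
by apply/unitrPr; exists (g 0%N); rewrite mulrC.
Qed.

Fact invfps_out : {in [predC unitfps], invfps =1 id}.
Proof. by move=> f; rewrite inE /= unfold_in /invfps /unitfps => /negbTE ->. Qed.

HB.instance Definition _ :=
  GRing.ComNzRing_hasMulInverse.Build (fps R) mulVfps unitfpsPl invfps_out.
End FpsUnitRing.

Notation "a %:S" := (constfps a) (at level 1, format "a %:S") : ring_scope.

(* [expx a], [coshx a], ... are the series e^(a x), cosh(a x), ... in x. *)
Section Series.
Variable F : fieldType.
Implicit Types a : F.

Definition expx a : fps F := Fps (fun n => a ^+ n / n`!%:R).
Definition coshx a : fps F := (expx a + expx (- a)) / 2%:R.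
Definition sinhx a : fps F := (expx a - expx (- a)) / 2%:R.
Definition tanhx a : fps F := sinhx a / coshx a.
End Series.

Section Permutations.
Variables (n : nat) (p : 'S_n).

Definition oneline : seq nat := [seq (val (p i)).+1 | i <- enum 'I_n].

(* The i-th letter, for 1 <= i <= n: positions are numbered from 1. *)
Definition letter (i : nat) : nat := nth 0%N oneline i.-1.

Definition descent (i : nat) : bool :=
  (1 <= i < n)%N && (letter i > letter i.+1)%N.

Definition ascent (i : nat) : bool := (1 <= i <= n)%N && ~~ descent i.

Definition first_ascent (k : nat) : bool :=
  ascent k && [forall j : 'I_n.+1, ascent j ==> (k <= j)%N].

Definition desarrangement : bool :=
  (n == 0%N) || [exists k : 'I_n.+1, first_ascent k && ~~ odd k].

Definition peak (i : nat) : bool :=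
  [&& 2 <= i < n, letter i.-1 < letter i & letter i > letter i.+1]%N.

Definition valley (i : nat) : bool :=
  [&& 2 <= i < n, letter i.-1 > letter i & letter i < letter i.+1]%N.

Definition pk : nat := #|[set i : 'I_n | peak i]|.
Definition vl : nat := #|[set i : 'I_n | valley i]|.
End Permutations.

Definition desGF (F : fieldType) (st : forall n : nat, 'S_n -> nat) (t : F) :
    fps F :=
  Fps (fun n => (\sum_(p : 'S_n | desarrangement p) t ^+ st n p) / n`!%:R).

(* Main.v *)
(**
Split a nonempty permutation at its largest letter, [u m v]. The letter [m] is a
peak exactly when [u] and [v] are nonempty, so the series [P] of all permutations
by peaks satisfies [P' = (P - 1) (1 - t + t P) + P]. The first ascent of [u m v]
is that of [u] if [u] is nonempty, and one more than that of [v] otherwise, so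
[D = D^pk] satisfies [D' = (D - 1) (1 - t + t P) + (P - D)].

For valleys, split at the smallest letter instead. The first ascent of [u m v] is
that of [u] unless [u] is decreasing, in which case it is [|u| + 1]. Decreasing
words counted with sign [(-1)^|u|] have series [e^-x], whence
[D' = (D - e^-x) (1 - t + t P)] for [D = D^val].

The closed forms solve these equations. That the sum of a weight over the
orderings of a finite set of letters depends only on its cardinality comes out of
the same induction, so words never have to be standardized.
*)
Require Import Defs.
From mathcomp Require Import all_boot all_order all_algebra all_fingroup.
From mathcomp Require Import ring zify.

Set Implicit Arguments.
Unset Strict Implicit.
Unset Printing Implicit Defensive.

Import GRing.Theory.
Local Open Scope ring_scope.

(** * Formal derivative of power series *)

Section FpsDerivative.
Variable R : comNzRingType.
Implicit Types f g : fps R.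

Definition dfps f : fps R := Fps (fun n => f n.+1 *+ n.+1).

Lemma dfpsD f g : dfps (f + g) = dfps f + dfps g.
Proof. by apply/fpsP => n /=; rewrite mulrnDl. Qed.

Lemma dfpsN f : dfps (- f) = - dfps f.
Proof. by apply/fpsP => n /=; rewrite mulNrn. Qed.

Lemma dfpsC (a : R) : dfps a%:S = 0.
Proof. by apply/fpsP => n /=; rewrite mul0rn. Qed.

(** A coefficient of a product involves finitely many coefficients of the factors, so the product
    rule is inherited from polynomials by truncation. *)
Lemma dfpsM f g : dfps (f * g) = dfps f * g + f * dfps g.
Proof.
have mulE m n (h k : fps R) :
    (n < m)%N -> (h * k) n = (truncfps m h * truncfps m k)`_n.
  exact: coef_mulfps.
have trunc_deriv h n : (truncfps n.+2 h)^`() = truncfps n.+1 (dfps h).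
  apply/polyP => i; rewrite coef_deriv !coef_poly /= ltnS.
  by case: ifP => // _; rewrite mul0rn.
have trunc_mul (h k : fps R) n :
    (truncfps n.+1 h * truncfps n.+2 k)`_n = (h * k) n.
  rewrite (@mulE n.+1) // !coefM; apply: eq_bigr => i _; congr (_ * _).
  have lt_ni : (n - i < n.+1)%N by rewrite ltnS leq_subr.
  by rewrite !coef_poly lt_ni (leqW lt_ni).
apply/fpsP => n.
rewrite -[LHS]/((f * g) n.+1 *+ n.+1) (@mulE n.+2) //.
rewrite -coef_deriv derivM coefD !trunc_deriv trunc_mul.
by rewrite [truncfps _ f * _]mulrC trunc_mul [dfps g * f]mulrC.
Qed.

End FpsDerivative.

(** * Constant series and constant terms *)

Section Constants.
Variable R : comNzRingType.

Lemma mulfps0 (f g : fps R) : (f * g) 0%N = f 0%N * g 0%N.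
Proof. by rewrite [LHS]big_ord_recl big_ord0 addr0. Qed.

Lemma constfpsN (a : R) : (- a)%:S = - a%:S.
Proof. by apply/fpsP => -[|n] //=; rewrite oppr0. Qed.

Lemma constfpsD (a b : R) : (a + b)%:S = a%:S + b%:S.
Proof. by apply/fpsP => -[|n] //=; rewrite addr0. Qed.

Lemma constfpsM (a b : R) : (a * b)%:S = a%:S * b%:S.
Proof.
apply/fpsP => -[|n]; first by rewrite mulfps0.
by rewrite [RHS]big_ord_recl /= mulr0 big1 ?addr0 // => i _; rewrite mul0r.
Qed.

Lemma constfps_nat n : n%:R%:S = n%:R :> fps R.
Proof.
elim: n => [|n IHn]; first by apply/fpsP => -[].
by rewrite -natr1 constfpsD IHn -natr1.
Qed.

Lemma constfpsME (a : R) (f : fps R) n : (a%:S * f) n = a * f n.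
Proof.
by rewrite [LHS]big_ord_recl /= subn0 big1 ?addr0 // => i _; rewrite mul0r.
Qed.
End Constants.

(** * Derivatives and constant terms of the exponential and hyperbolic series *)

Section HyperbolicSeries.
Variable F : fieldType.
Hypothesis natF_neq0 : forall n, n.+1%:R != 0 :> F.
Implicit Types a : F.

Lemma factF_neq0 n : n`!%:R != 0 :> F.
Proof. by have := fact_gt0 n; case: n`! => // m _. Qed.

Lemma natfps_unit n : (n.+1%:R : fps F) \is a GRing.unit.
Proof.
rewrite -constfps_nat; suff : n.+1%:R \is a @GRing.unit F by [].
by rewrite unitfE natF_neq0.
Qed.

Lemma dfps_expx a : dfps (expx a) = a%:S * expx a.
Proof.
apply/fpsP => n; rewrite constfpsME /= -mulr_natr factS natrM exprS.
by field; rewrite factF_neq0 nat1r natF_neq0.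
Qed.

Lemma expx0 a : expx a 0%N = 1.
Proof. by rewrite /= expr0 fact0 divr1. Qed.

Lemma coshxE a : 2%:R * coshx a = expx a + expx (- a).
Proof. by rewrite mulrC divrK // natfps_unit. Qed.

Lemma sinhxE a : 2%:R * sinhx a = expx a - expx (- a).
Proof. by rewrite mulrC divrK // natfps_unit. Qed.

(** Identities for cosh and sinh are proved after doubling, which removes the division by 2. *)
Lemma mul2fps_inj : injective (fun f : fps F => 2%:R * f).
Proof. exact: mulrI (natfps_unit 1). Qed.

Lemma dfps_mul2 (f : fps F) : dfps (2%:R * f) = 2%:R * dfps f.
Proof. by rewrite dfpsM -constfps_nat dfpsC mul0r add0r. Qed.

Lemma dfps_coshx a : dfps (coshx a) = a%:S * sinhx a.
Proof.
apply: mul2fps_inj; rewrite -dfps_mul2 coshxE mulrCA sinhxE.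
by rewrite dfpsD !dfps_expx constfpsN; ring.
Qed.

Lemma dfps_sinhx a : dfps (sinhx a) = a%:S * coshx a.
Proof.
apply: mul2fps_inj; rewrite -dfps_mul2 sinhxE mulrCA coshxE.
by rewrite dfpsD dfpsN !dfps_expx constfpsN; ring.
Qed.

Lemma coshx0 a : coshx a 0%N = 1.
Proof.
apply: (mulfI (natF_neq0 1)); rewrite -constfpsME constfps_nat coshxE.
by rewrite [LHS]/= !expr0 fact0 divr1 mulr1.
Qed.

Lemma sinhx0 a : sinhx a 0%N = 0.
Proof.
apply: (mulfI (natF_neq0 1)); rewrite -constfpsME constfps_nat sinhxE.
by rewrite [LHS]/= !expr0 subrr mulr0.
Qed.

End HyperbolicSeries.

(** * Peaks and initial runs of a word split at an extremal letter *)

Section Words.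
Implicit Types (r : rel nat) (u v w : seq nat).

(** Taking [ltn] for [r] counts peaks and [gtn] counts valleys, so both statistics share one
    recursion. *)
Fixpoint npeaks r w : nat :=
  if w is x :: w' then
    ((if w' is y :: z :: _ then r x y && r z y else false) + npeaks r w')%N
  else 0%N.

Definition asym r := forall x y, r x y -> ~~ r y x.

(** By asymmetry a neighbour of [m] is not a peak, just as an end letter of [u] or [v] is not one;
    only [m] itself can add a peak. *)
Lemma npeaks_split r u m v : asym r -> all (r^~ m) u -> all (r^~ m) v ->
  npeaks r (u ++ m :: v) = (npeaks r u + npeaks r v + (~~ nilp u && ~~ nilp v))%N.
Proof.
move=> asym_r; elim: u => [|x u IHu] /=.
  case: v => [|y [|z v]] //= _; rewrite ?addn0 // => /and3P[/asym_r ym _ _].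
  by rewrite (negPf ym) add0n.
case/andP=> rxm rum rvm; rewrite (IHu rum rvm).
case: u {IHu} rum => [|y [|z u]] /=.
- case: v rvm => [|y v] //= /andP[rym _] _.
  by rewrite rxm rym /= add0n addn0 addnC.
- case/andP=> /asym_r rmy _; rewrite (negPf rmy) andbF.
  by case: v rvm => //= *; rewrite ?add0n ?addn0.
- by move=> _; rewrite !addnA.
Qed.

(* The first ascent of a nonempty word: the length of its initial
   decreasing run. *)
Fixpoint run w : nat :=
  if w is x :: w' then if (head x w' < x)%N then (run w').+1 else 1%N else 0%N.

(** The empty word has run 0 and so satisfies this, in agreement with the empty permutation. *)
Definition desw w := ~~ odd (run w).

(** No letter descends to the maximum, so the run ends within a nonempty [u]; if [u] is empty, the
    maximum prolongs the run of [v] by one. *)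
Lemma run_max u m v : all (ltn^~ m) u -> all (ltn^~ m) v ->
  run (u ++ m :: v) = if nilp u then (run v).+1 else run u.
Proof.
elim: u => [|x u IHu] /=.
  by case: v => [|y v] /=; rewrite ?ltnn // => _ /andP[->].
case/andP=> ltxm ltum ltvm; rewrite (IHu ltum ltvm).
by case: u {IHu} ltum => [|y u] //= _; rewrite ltnn ltnNge (ltnW ltxm).
Qed.

(** Only a decreasing [u] lets the run reach the minimum, and there it must stop. *)
Lemma run_min u m v : all (gtn^~ m) u -> all (gtn^~ m) v ->
  run (u ++ m :: v) = if sorted gtn u then (size u).+1 else run u.
Proof.
elim: u => [|x u IHu] /=.
  case: v => [|y v] /=; rewrite ?ltnn // => _ /andP[/ltnW].
  by rewrite leqNgt => /negPf ->.
case/andP=> gtxm gtum gtvm; rewrite (IHu gtum gtvm).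
case: u {IHu} gtum => [|y u] /=; first by rewrite gtxm.
by move=> _; case: ifP => //= _; case: ifP.
Qed.

Lemma run_sorted u : sorted gtn u -> run u = size u.
Proof.
elim: u => [|x [|y u] IHu] //=; first by rewrite ltnn.
by case/andP=> -> /IHu /= ->.
Qed.

Lemma npeaks_sorted u : sorted gtn u -> npeaks gtn u = 0%N.
Proof.
elim: u => [|x [|y [|z u]] IHu] //= /andP[xy yzu].
have /= -> := IHu yzu; case/andP: yzu => yz _.
by rewrite addn0 [(y < z)%N]ltnNge (ltnW yz) andbF.
Qed.

Lemma sorted_min u m v : all (gtn^~ m) u -> all (gtn^~ m) v ->
  sorted gtn (u ++ m :: v) = sorted gtn u && nilp v.
Proof.
elim: u => [|x u IHu] /=.
  by case: v => [|y v] //= _ /andP[/ltnW]; rewrite leqNgt => /negPf ->.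
case/andP=> gtxm gtum gtvm; case: u IHu gtum => [|y u] IHu gtum /=.
  by rewrite gtxm /=; exact: (IHu isT gtvm).
by rewrite -andbA -(IHu gtum gtvm).
Qed.

End Words.

(** * Orderings of a finite set, split at a chosen letter *)

Lemma mem_permutations_enum (T : finType) (A : {set T}) w :
  reflect (uniq w /\ w =i A) (w \in permutations (enum A)).
Proof.
rewrite mem_permutations; apply: (iffP idP) => [Aw|[uw wA]].
  split; first by rewrite (perm_uniq Aw) enum_uniq.
  by move=> x; rewrite (perm_mem Aw) mem_enum.
by apply: uniq_perm; rewrite ?enum_uniq // => x; rewrite wA mem_enum.
Qed.

(** An ordering of [A] amounts to the set [B] of letters before [m], an ordering of [B], and an
    ordering of the remaining letters after [m]. *)
Lemma permutations_split (T : finType) (A : {set T}) m : m \in A ->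
  perm_eq (permutations (enum A))
    [seq st.1 ++ m :: st.2 | B <- enum (powerset (A :\ m)),
       st <- [seq (s, t) | s <- permutations (enum B),
                           t <- permutations (enum (A :\ m :\: B))]].
Proof.
move=> mA; apply: uniq_perm; first exact: permutations_uniq.
- apply: allpairs_uniq_dep; first exact: enum_uniq.
    move=> B _; apply: allpairs_uniq; rewrite ?permutations_uniq //.
    by move=> [s t] [s' t'].
  (* Since [m] is not in [B], its index is the length of [s]; the word thus determines [s] and [t],
     and [s] determines [B]. *)
  have index_m B (s t : seq T) : B \in enum (powerset (A :\ m)) ->
      s \in permutations (enum B) -> index m (s ++ m :: t) = size s.
    rewrite mem_enum inE => sBA /mem_permutations_enum[_ sB].
    rewrite index_cat sB /= eqxx addn0; case: ifP => // mB.
    by have := subsetP sBA _ mB; rewrite !inE eqxx.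
  move=> p p' /allpairsPdep[B [_ [BP /allpairsP[[s1 t1] /= [Bs _ ->]] ->]]].
  move=> /allpairsPdep[B' [_ [BP' /allpairsP[[s2 t2] /= [Bs' _ ->]] ->]]] /=.
  move=> eq_st; have eq_size : size s1 = size s2.
    by rewrite -(index_m B s1 t1) // eq_st (index_m B').
  move/eqP: eq_st; rewrite eqseq_cat // => /andP[/eqP eq_s /eqP[eq_t]].
  suff -> : B = B' by rewrite eq_s eq_t.
  apply/setP => x; case/mem_permutations_enum: Bs => _ <-.
  by case/mem_permutations_enum: Bs' => _ <-; rewrite eq_s.
move=> w; apply/mem_permutations_enum/allpairsPdep => [[uw wA]|].
  have /splitPr wm : m \in w by rewrite wA.
  case: wm uw wA => s t; rewrite cat_uniq /= negb_or.
  case/and3P=> us /andP[ms st] /andP[mt ut] wA.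
  exists [set x in s], (s, t); split=> //.
    rewrite mem_enum inE; apply/subsetP => x; rewrite !inE => xs.
    by rewrite -wA mem_cat xs andbT; apply: contraNneq ms => <-.
  apply/allpairsP; exists (s, t); split=> //=; apply/mem_permutations_enum.
    by split=> // x; rewrite inE.
  split=> // x; rewrite !inE -wA mem_cat inE.
  case: (boolP (x \in s)) => [xs|_] /=.
    by apply/negbTE; apply: contra st => xt; apply/hasP; exists x.
  by case: eqVneq => [->|] /=; first exact/negbTE.
case=> B [_ [+ /allpairsP[[s t] /= [+ + ->]] ->]].
rewrite mem_enum inE => sBA /mem_permutations_enum[us sB].
case/mem_permutations_enum=> ut tB; split=> /=.
  have mB : m \notin B by apply/negP => /(subsetP sBA m); rewrite !inE eqxx.
  have st : ~~ has (mem s) t.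
    by apply/hasPn => x /=; rewrite tB sB !inE => /andP[].
  by rewrite cat_uniq /= us ut negb_or st sB mB tB !inE eqxx andbF.
move=> x; rewrite mem_cat inE sB tB !inE.
case: eqVneq => [->|xm] /=; first by rewrite mA orbT.
case: (boolP (x \in B)) => //= xB.
by have := subsetP sBA _ xB; rewrite !inE xm /= => ->.
Qed.

(** * Exponential generating functions of weights on words *)

Section ExponentialGeneratingFunctions.
Variable L : fieldType.
Implicit Types (f g h : seq nat -> L) (F G H : fps L).

(** Letters are shifted by one to agree with [oneline]. *)
Definition permsum N f (A : {set 'I_N}) : L :=
  \sum_(w <- permutations (enum A)) f [seq (val i).+1 | i <- w].

(** This says both that the sum depends only on the cardinality and that [F] is its generating
    function; the bound [n] is the induction parameter. *)
Definition egf_upto n f F := forall N (A : {set 'I_N}),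
  (#|A| <= n)%N -> permsum f A = #|A|`!%:R * F #|A|.

Lemma sum_subsets (T : finType) (A : {set T}) (phi : nat -> L) :
  \sum_(B : {set T} | B \subset A) phi #|B|
    = \sum_(k < #|A|.+1) phi k *+ 'C(#|A|, k).
Proof.
rewrite (partition_big (fun B : {set T} => inord #|B| : 'I_#|A|.+1) xpredT) //=.
apply: eq_bigr => k _.
have cardE (B : {set T}) :
    (B \subset A) && (inord #|B| == k)
    = (B \in [set B : {set T} | B \subset A & #|B| == k]).
  rewrite inE; case: (boolP (B \subset A)) => //= sBA.
  by rewrite -val_eqE /= inordK // ltnS subset_leq_card.
rewrite (eq_bigl _ _ cardE) -cards_draws -sumr_const.
by apply: eq_bigr => B; rewrite inE => /andP[_ /eqP->].
Qed.

(** Binomial convolution: the ['C(#|A|, k)] subsets of size [k] turn the two factorials into that of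
    [#|A|]. *)
Lemma egf_mul n g G h H N (A : {set 'I_N}) :
    egf_upto n g G -> egf_upto n h H -> (#|A| <= n)%N ->
  \sum_(B : {set 'I_N} | B \subset A) permsum g B * permsum h (A :\: B)
    = #|A|`!%:R * (G * H) #|A|.
Proof.
move=> gG hH leAn.
pose phi k := k`!%:R * G k * ((#|A| - k)`!%:R * H (#|A| - k)%N).
transitivity (\sum_(B : {set 'I_N} | B \subset A) phi #|B|).
  apply: eq_bigr => B sBA; rewrite gG ?hH ?cardsDS //.
    exact: leq_trans (leq_subr _ _) leAn.
  exact: leq_trans (subset_leq_card sBA) leAn.
rewrite sum_subsets mulr_sumr; apply: eq_bigr => k _.
rewrite -(bin_fact (leq_ord k)) !natrM /phi -mulr_natr; ring.
Qed.

Lemma egfD n f g F G : egf_upto n f F -> egf_upto n g G ->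
  egf_upto n (fun w => f w + g w) (F + G).
Proof.
move=> fF gG N A leAn; rewrite /permsum big_split /= mulrDr.
by congr (_ + _); [apply: fF|apply: gG].
Qed.

Lemma egfZ n a f F : egf_upto n f F -> egf_upto n (fun w => a * f w) (a%:S * F).
Proof.
move=> fF N A leAn; rewrite /permsum -mulr_sumr constfpsME mulrCA.
by congr (_ * _); apply: fF.
Qed.

Lemma egfB n f g F G : egf_upto n f F -> egf_upto n g G ->
  egf_upto n (fun w => f w - g w) (F - G).
Proof.
move=> fF gG N A leAn; rewrite /permsum big_split /= sumrN mulrDr mulrN.
by congr (_ - _); [apply: fF|apply: gG].
Qed.

Lemma permsum0 N f : permsum f (set0 : {set 'I_N}) = f [::].
Proof. by rewrite /permsum enum_set0 big_seq1. Qed.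

Lemma egf_nilp n : egf_upto n (fun w => (nilp w)%:R) 1.
Proof.
move=> N A _; have [->|A0] := eqVneq A set0.
  by rewrite permsum0 cards0 fact0 mulr1.
rewrite -cards_eq0 in A0; rewrite /= (negPf A0) mulr0 /permsum big1_seq // => w.
rewrite mem_permutations => /andP[_ /perm_size].
by rewrite /nilp size_map -cardE => ->; rewrite (negPf A0).
Qed.

Definition extremal (r : rel nat) := forall N (A : {set 'I_N}), A != set0 ->
  exists2 m, m \in A & {in A :\ m, forall x : 'I_N, r x.+1 m.+1}.

Lemma extremal_ltn : extremal ltn.
Proof.
move=> N A /set0Pn[i0 Ai0].
case: (@arg_maxnP _ i0 (mem A) (fun i : 'I_N => i : nat) Ai0) => m Am max_m.
exists m => // x; rewrite !inE => /andP[xm /max_m].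
by rewrite /= ltnS ltn_neqAle => ->; rewrite val_eqE xm.
Qed.

Lemma extremal_gtn : extremal gtn.
Proof.
move=> N A /set0Pn[i0 Ai0].
case: (@arg_minnP _ i0 (mem A) (fun i : 'I_N => i : nat) Ai0) => m Am min_m.
exists m => // x; rewrite !inE => /andP[xm /min_m].
by rewrite /= ltnS ltn_neqAle => ->; rewrite eq_sym val_eqE xm.
Qed.

(** The induction step used for every weight: deleting the extremal letter corresponds to
    differentiating, and the words on its two sides give a product of series. Two products leave
    room for a separate treatment of empty [u]. *)
Lemma egf_split r n f F g1 G1 h1 H1 g2 G2 h2 H2 :
    extremal r -> f [::] = F 0%N -> dfps F = G1 * H1 + G2 * H2 ->
    (forall u m v, all (r^~ m) u -> all (r^~ m) v ->
       f (u ++ m :: v) = g1 u * h1 v + g2 u * h2 v) ->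
    egf_upto n g1 G1 -> egf_upto n h1 H1 ->
    egf_upto n g2 G2 -> egf_upto n h2 H2 ->
  egf_upto n.+1 f F.
Proof.
move=> ext_r f0 dF fE gG1 hH1 gG2 hH2 N A leAn.
have [->|A0] := eqVneq A set0; first by rewrite permsum0 cards0 fact0 mul1r.
have [m mA m_max] := ext_r N A A0.
rewrite /permsum (perm_big _ (permutations_split mA)) big_allpairs_dep /=.
rewrite big_enum /=.
transitivity (\sum_(B : {set 'I_N} | B \subset A :\ m)
   (permsum g1 B * permsum h1 (A :\ m :\: B)
    + permsum g2 B * permsum h2 (A :\ m :\: B))).
  apply: eq_big => [B|B]; rewrite !inE // => sBA.
  rewrite big_allpairs_dep !big_distrlr -big_split /=.
  apply: eq_big_seq => s /mem_permutations_enum[_ sB].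
  rewrite -big_split /=; apply: eq_big_seq => t /mem_permutations_enum[_ tB].
  rewrite map_cat /= fE //; apply/allP => _ /mapP[x + ->]; rewrite ?sB ?tB.
    by move=> xB; apply: m_max; exact: (subsetP sBA).
  by rewrite inE => /andP[_]; exact: m_max.
have cardA : #|A| = #|A :\ m|.+1 by rewrite (cardsD1 m A) mA.
have leA'n : (#|A :\ m| <= n)%N by rewrite -ltnS -cardA.
rewrite big_split /= (egf_mul gG1 hH1) // (egf_mul gG2 hH2) // -mulrDr cardA.
(* The coefficient of [dfps F] in degree [#|A| - 1] is [#|A|] times that of [F] in degree [#|A|]. *)
have /fpsP/(_ #|A :\ m|)/= := dF; rewrite /= -mulr_natl => <-.
by rewrite factS natrM; ring.
Qed.

End ExponentialGeneratingFunctions.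

(** * From statistics of permutations to statistics of their words *)

Section WordsOfPermutations.
Implicit Types w : seq nat.

Lemma npeaks_nth r w : npeaks r w = (\sum_(0 <= i < (size w).-2)
  (r (nth 0 w i) (nth 0 w i.+1) && r (nth 0 w i.+2) (nth 0 w i.+1)))%N.
Proof.
elim: w => [|x w IHw]; first by rewrite big_nil.
rewrite [LHS]/= IHw; case: w {IHw} => [|y [|z w]]; rewrite ?big_nil //=.
by rewrite [RHS]big_nat_recl.
Qed.

Lemma run_le_size w : (run w <= size w)%N.
Proof. by elim: w => //= x w IHw; case: ifP. Qed.

Lemma run_gt0 w : (0 < size w)%N -> (0 < run w)%N.
Proof. by case: w => //= x w _; case: ifP. Qed.

(** Together with [run_ascent], this identifies the length of the initial run with the first
    ascent. *)
Lemma run_descent w j : (j.+1 < run w)%N -> (nth 0 w j.+1 < nth 0 w j)%N.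
Proof.
elim: w j => [|x w IHw] [|j] //=; case: ifP => // hd; last exact: IHw.
by case: w hd {IHw} => //= _.
Qed.

Lemma run_ascent w : (0 < run w < size w)%N ->
  ~~ (nth 0 w (run w) < nth 0 w (run w).-1)%N.
Proof.
elim: w => //= x w IHw; case: ifP => hd /=; last first.
  by case: w hd {IHw} => [|y w] //= ->.
case: w hd IHw => [|y w] hd IHw; first by rewrite ltnn in hd.
by rewrite ltnS => rw; have := IHw; rewrite run_gt0 //= rw => /(_ isT); case: ifP.
Qed.

Variables (n : nat) (p : 'S_n).

Lemma size_oneline : size (oneline p) = n.
Proof. by rewrite size_map size_enum_ord. Qed.

Lemma desarrangement_desw : desarrangement p = desw (oneline p).
Proof.
rewrite /desarrangement /desw; set w := oneline p.
have szw : size w = n by exact: size_oneline.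
have [n0|n_gt0] := posnP n.
  by rewrite (_ : w = [::]) //; apply/nilP; rewrite /nilp szw n0.
rewrite /=; have run_gt0 : (0 < run w)%N by rewrite run_gt0 ?szw.
have run_len : (run w <= n)%N by rewrite -szw run_le_size.
(* Positions count from 1 but [nth] counts from 0, so position [j] compares entries [j.-1] and
   [j]. *)
have descentE j : descent p j = (0 < j < n)%N && (nth 0 w j < nth 0 w j.-1)%N.
  by [].
(* If the run is the whole word, its end is position [n], an ascent by convention. *)
have asc_run : ascent p (run w).
  rewrite /ascent run_gt0 run_len /= descentE; case: andP => // -[rn].
  by move: (@run_ascent w); rewrite szw rn => /(_ isT)/negPf ->.
have run_min j : ascent p j -> (run w <= j)%N.
  rewrite leqNgt; apply: contraL => ltj; rewrite /ascent negb_and negbK.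
  case: j ltj => //= j ltj; rewrite descentE /= run_descent //.
  by rewrite (leq_trans ltj) // orbT.
apply/existsP/idP => [[k /andP[/andP[asc_k /forallP min_k]]]|odd_run].
  have k_run : (k <= run w)%N.
    by have /implyP := min_k (Ordinal (n:=n.+1) (m:=run w) run_len); apply.
  suff -> : run w = k by [].
  by apply/eqP; rewrite eqn_leq run_min.
exists (Ordinal (n:=n.+1) (m:=run w) run_len); rewrite odd_run andbT.
rewrite /first_ascent asc_run; apply/forallP => j; exact/implyP/run_min.
Qed.

(** Peaks and valleys start at position 2; this reindexing matches the windows of three letters in
    [npeaks_nth]. *)
Lemma card_ord_ge2 (P : pred nat) : ~~ P 0%N -> ~~ P 1%N ->
  #|[set i : 'I_n | P i]| = (\sum_(0 <= i < n.-2) P i.+2)%N.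
Proof.
move=> P0 P1; rewrite -sum1_card.
under eq_bigl do rewrite inE.
rewrite big_mkcond /= -(big_mkord xpredT (fun i => if P i then 1 else 0)%N).
case: n => [|[|m]] /=; rewrite ?big_nil ?big_nat1 ?(negPf P0) //.
rewrite big_nat_recl // big_nat_recl // (negPf P0) (negPf P1) !add0n.
by apply: eq_bigr => i _; case: (P _).
Qed.

Lemma pk_npeaks : pk p = npeaks ltn (oneline p).
Proof.
rewrite /pk card_ord_ge2 // npeaks_nth size_oneline.
apply: eq_big_nat => i lt_i; rewrite /peak /letter /=.
by rewrite (_ : i.+2 < n)%N //; lia.
Qed.

Lemma vl_npeaks : vl p = npeaks gtn (oneline p).
Proof.
rewrite /vl card_ord_ge2 // npeaks_nth size_oneline.
apply: eq_big_nat => i lt_i; rewrite /valley /letter /=.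
by rewrite (_ : i.+2 < n)%N //; lia.
Qed.

End WordsOfPermutations.

(** * Differential equations characterizing the desarrangement series *)

Section DesarrangementSeries.
Variable L : fieldType.
Hypothesis natL_neq0 : forall n, n.+1%:R != 0 :> L.
Variable t : L.
Implicit Types (f : seq nat -> L) (F P D : fps L) (r : rel nat).

(** Distinct permutations give distinct orderings of ['I_n], and there are [n]! of each, so this
    injection is onto. *)
Lemma sum_oneline n f : \sum_(p : 'S_n) f (oneline p) = permsum f [set: 'I_n].
Proof.
pose word (p : 'S_n) := [seq p i | i <- enum 'I_n].
have inj_word : injective word.
  move=> p q /eq_in_map eq_pq; apply/permP => i.
  by apply: eq_pq; rewrite mem_enum.
have uniq_words : uniq [seq word p | p <- enum 'S_n].
  by rewrite map_inj_uniq ?enum_uniq.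
have words_sub : {subset [seq word p | p <- enum 'S_n]
                         <= permutations (enum [set: 'I_n])}.
  move=> _ /mapP[p _ ->]; apply/mem_permutations_enum; split.
    by rewrite map_inj_uniq ?enum_uniq //; exact: perm_inj.
  move=> i; rewrite inE; apply/mapP; exists (p^-1%g i); last by rewrite permKV.
  by rewrite mem_enum.
have words_perm : perm_eq (permutations (enum [set: 'I_n]))
                          [seq word p | p <- enum 'S_n].
  rewrite perm_sym; apply: uniq_perm; rewrite ?permutations_uniq //.
  case: (uniq_min_size uniq_words words_sub) => //.
  rewrite size_permutations ?enum_uniq // size_map -!cardE card_Sn cardsT.
  by rewrite card_ord.
rewrite /permsum (perm_big _ words_perm) big_map big_enum /=.
by apply: eq_bigr => p _; rewrite -map_comp.
Qed.

Lemma desGF_egf (st : forall n, 'S_n -> nat) f F :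
    (forall n (p : 'S_n),
       f (oneline p) = (desw (oneline p))%:R * t ^+ st n p) ->
    (forall n, egf_upto n f F) -> desGF st t = F.
Proof.
move=> fE fF; apply/fpsP => n /=; rewrite big_mkcond /=.
transitivity (permsum f [set: 'I_n] / n`!%:R).
  rewrite -sum_oneline; congr (_ / _); apply: eq_bigr => p _.
  by rewrite fE desarrangement_desw; case: ifP; rewrite ?mul1r ?mul0r.
by rewrite (fF n) cardsT card_ord // mulrC mulKf // factF_neq0.
Qed.

Lemma egf_upto0 f F : f [::] = F 0%N -> egf_upto 0 f F.
Proof.
move=> f0 N A; rewrite leqn0 cards_eq0 => /eqP ->.
by rewrite permsum0 cards0 fact0 mul1r.
Qed.

Definition peakw r w : L := t ^+ npeaks r w.

Definition peakw_ode P := dfps P = (P - 1) * ((1 - t)%:S + t%:S * P) + P.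

(* The factor contributed by [m :: w] to the weight of [u ++ m :: w], for [m]
   extremal and [u] nonempty: [m] is then a peak exactly when [w] is nonempty. *)
Definition rpeakw r w : L := (1 - t) * (nilp w)%:R + t * peakw r w.

Lemma egf_rpeakw r n P : egf_upto n (peakw r) P ->
  egf_upto n (rpeakw r) ((1 - t)%:S + t%:S * P).
Proof.
move=> rP; rewrite -[(1 - t)%:S]mulr1.
by apply: egfD; apply: egfZ => //; exact: egf_nilp.
Qed.

Lemma rpeakwE r w : rpeakw r w = t ^+ (npeaks r w + ~~ nilp w).
Proof.
rewrite /rpeakw /peakw; case: w => [|x w].
  by rewrite /= addn0 expr0; ring.
by rewrite [nilp _]/= mulr0 add0r addn1 exprS.
Qed.

(** The first product vanishes for empty [u]; the second covers exactly that case, where [m] comes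
    first and is no peak. *)
Lemma peakw_split r u m v : asym r -> all (r^~ m) u -> all (r^~ m) v ->
  peakw r (u ++ m :: v)
    = (peakw r u - (nilp u)%:R) * rpeakw r v + (nilp u)%:R * peakw r v.
Proof.
move=> asym_r um vm; rewrite rpeakwE /peakw npeaks_split //.
case: u um => [|x u] um; first by rewrite /= add0n addn0 expr0 subrr; ring.
by rewrite [nilp _]/= subr0 mul0r addr0 -addnA exprD.
Qed.

(** The recurrence uses only asymmetry and an extremal letter, so a single [P] serves both peaks and
    valleys. *)
Lemma egf_peakw r n P : asym r -> extremal r -> P 0%N = 1 -> peakw_ode P ->
  egf_upto n (peakw r) P.
Proof.
move=> asym_r ext_r P0 dP; elim: n => [|n IHn].
  by apply: egf_upto0; rewrite P0.
apply: (@egf_split _ r n _ _ (fun w => peakw r w - (nilp w)%:R) (P - 1)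
          (rpeakw r) ((1 - t)%:S + t%:S * P) (fun w => (nilp w)%:R) 1 _ P).
- exact: ext_r.
- by rewrite P0.
- by rewrite dP mul1r.
- by move=> u m v um vm; exact: peakw_split.
- by apply: egfB => //; exact: egf_nilp.
- exact: egf_rpeakw.
- exact: egf_nilp.
- exact: IHn.
Qed.

Definition despeakw r w : L := (desw w)%:R * peakw r w.

Lemma desGF_pk P D :
    P 0%N = 1 -> peakw_ode P -> D 0%N = 1 ->
    dfps D = (D - 1) * ((1 - t)%:S + t%:S * P) + (P - D) ->
  desGF pk t = D.
Proof.
move=> P0 dP D0 dD; apply: (@desGF_egf _ (despeakw ltn)) => [n p|n].
  by rewrite pk_npeaks.
have asym_lt : asym ltn by move=> x y /ltnW; rewrite /= -leqNgt.
have egfP k : egf_upto k (peakw ltn) P.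
  by apply: egf_peakw => //; exact: extremal_ltn.
elim: n => [|n IHn]; first by apply: egf_upto0; rewrite /despeakw mul1r D0.
(* A nonempty [u] decides the parity of the run. For empty [u] the maximum flips the parity of the
   run of [v], which leaves the complementary weight [peakw - despeakw]. *)
apply: (@egf_split _ ltn n _ _ (fun w => despeakw ltn w - (nilp w)%:R) (D - 1)
          (rpeakw ltn) ((1 - t)%:S + t%:S * P)
          (fun w => (nilp w)%:R) 1
          (fun w => peakw ltn w - despeakw ltn w) (P - D)).
- exact: extremal_ltn.
- by rewrite /despeakw mul1r D0.
- by rewrite dD mul1r.
- move=> u m v um vm; rewrite /despeakw peakw_split // /desw run_max //.
  case: u um => [|x u] um; last by rewrite /= subr0; ring.
  by rewrite /peakw /=; case: odd; rewrite /= expr0; ring.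
- by apply: egfB => //; exact: egf_nilp.
- exact: egf_rpeakw.
- exact: egf_nilp.
- exact: egfB.
Qed.

(* Subtracting this from the desarrangement weight flips the parity on decreasing
   words, whose initial run grows by one when the minimum is appended. *)
Definition signdec (w : seq nat) : L := (sorted gtn w)%:R * (-1) ^+ size w.

(** In a decreasing word the minimum comes last, and removing it changes the sign: this is the
    equation [F' = -F]. *)
Lemma egf_signdec n : egf_upto n signdec (expx (-1)).
Proof.
have s0 : signdec [::] = expx (-1) 0%N by rewrite expx0 /signdec mul1r expr0.
elim: n => [|n IHn]; first exact: egf_upto0.
apply: (@egf_split _ gtn n _ _ (fun w => -1 * signdec w) ((-1)%:S * expx (-1))
          (fun w => (nilp w)%:R) 1 (fun w => (nilp w)%:R - (nilp w)%:R) (1 - 1)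
          (fun w => (nilp w)%:R) 1).
- exact: extremal_gtn.
- by [].
- by rewrite dfps_expx // subrr mul0r addr0 mulr1.
- move=> u m v um vm; rewrite /signdec sorted_min // subrr mul0r addr0.
  case: v vm => [|y v] _; last by rewrite andbF /=; ring.
  by rewrite size_cat addn1 exprS andbT /=; ring.
- exact: egfZ.
- exact: egf_nilp.
- by apply: egfB; exact: egf_nilp.
- exact: egf_nilp.
Qed.

Lemma desGF_vl P D :
    P 0%N = 1 -> peakw_ode P -> D 0%N = 1 ->
    dfps D = (D - expx (-1)) * ((1 - t)%:S + t%:S * P) ->
  desGF vl t = D.
Proof.
move=> P0 dP D0 dD; apply: (@desGF_egf _ (despeakw gtn)) => [n p|n].
  by rewrite vl_npeaks.
have asym_gt : asym gtn by move=> x y /ltnW; rewrite /= -leqNgt.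
have egfP k : egf_upto k (peakw gtn) P.
  by apply: egf_peakw => //; exact: extremal_gtn.
elim: n => [|n IHn]; first by apply: egf_upto0; rewrite /despeakw mul1r D0.
(* For empty [u] the first factor is 1 - 1 = 0, as it should be, since the run then has length 1.
   One product therefore covers all cases, and the second is zero. *)
apply: (@egf_split _ gtn n _ _ (fun w => despeakw gtn w - signdec w)
          (D - expx (-1)) (rpeakw gtn) ((1 - t)%:S + t%:S * P)
          (fun w => (nilp w)%:R - (nilp w)%:R) (1 - 1)
          (fun w => (nilp w)%:R) 1).
- exact: extremal_gtn.
- by rewrite /despeakw mul1r D0.
- by rewrite dD subrr mul0r addr0.
- move=> u m v um vm; rewrite subrr mul0r addr0 /despeakw peakw_split //.
  rewrite /desw run_min // /signdec.
  case: ifP => [sort_u|nsort_u]; last first.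
    by case: u um nsort_u => [|x u] //= _ _; ring.
  rewrite run_sorted // /peakw npeaks_sorted // expr0 -signr_odd.
  case: u um sort_u => [|x u] um _; first by rewrite /= expr0; ring.
  by rewrite /=; case: odd; rewrite /= ?expr0 ?expr1; ring.
- by apply: egfB => //; exact: egf_signdec.
- exact: egf_rpeakw.
- by apply: egfB; exact: egf_nilp.
- exact: egf_nilp.
Qed.

(** * The closed forms satisfy the differential equations *)

Section ClosedForms.
Variable s : L.
Hypotheses (s2 : s ^+ 2 = 1 - t) (s_neq0 : s != 0) (t_neq0 : t != 0).

Definition denom := s%:S * coshx s - sinhx s.

Lemma denom0 : denom 0%N = s.
Proof.
rewrite -[LHS]/((s%:S * coshx s) 0%N - sinhx s 0%N).
by rewrite mulfps0 coshx0 // sinhx0 // mulr1 subr0.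
Qed.

Lemma denom_unit : denom \is a GRing.unit.
Proof.
suff : denom 0%N \is a GRing.unit by [].
by rewrite denom0 unitfE.
Qed.

Lemma dfps_denom : dfps denom = s%:S * (s%:S * sinhx s) - s%:S * coshx s.
Proof.
by rewrite dfpsD dfpsN dfpsM dfpsC mul0r add0r dfps_coshx // dfps_sinhx.
Qed.

(** Eliminating [t] reduces the differential equations to polynomial identities in [s], cosh, sinh
    and the exponential. *)
Lemma constfps_t : t%:S = 1 - s%:S ^+ 2.
Proof.
have -> : t = 1 - s ^+ 2 by rewrite s2 opprB addrC subrK.
by rewrite constfpsD constfpsN expr2 constfpsM.
Qed.

Lemma quotient0 (f : fps L) : (f / denom) 0%N = f 0%N / s.
Proof.
apply: (mulIf s_neq0); rewrite -[in LHS]denom0 -mulfps0.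
by rewrite !divrK // ?denom_unit // unitfE.
Qed.

(** The quotient rule with denominators cleared, from the product rule for [f / denom * denom]. *)
Lemma dfps_quotient (f : fps L) :
  dfps (f / denom) * denom ^+ 2 = dfps f * denom - f * dfps denom.
Proof.
have := dfpsM (f / denom) denom; rewrite divrK ?denom_unit // => ->.
rewrite -[X in _ - X * _](divrK denom_unit f); ring.
Qed.

(** The closed form of the series [P] of all permutations by peaks. *)
Definition peakGF := s%:S * coshx s / denom.

Lemma peakGF0 : peakGF 0%N = 1.
Proof. by rewrite quotient0 mulfps0 coshx0 // mulr1 /= divff. Qed.

Lemma peakGF_ode : peakw_ode peakGF.
Proof.
apply: (mulIr (unitrX 2 denom_unit)); rewrite dfps_quotient.
have PQ : peakGF * denom = s%:S * coshx s by rewrite divrK ?denom_unit.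
transitivity ((peakGF * denom - denom) *
    ((1 - t)%:S * denom + t%:S * (peakGF * denom)) + peakGF * denom * denom);
  last by ring.
rewrite PQ dfps_denom dfpsM dfpsC dfps_coshx // /denom.
by rewrite constfpsD constfpsN -[1%:S]/(1 : fps L) constfps_t; ring.
Qed.

Definition despkGF := 1 - (t^-1)%:S + (t^-1)%:S * expx (-1) * s%:S / denom.

Lemma constfps_tV : t%:S * (t^-1)%:S = 1.
Proof. by rewrite -constfpsM divff. Qed.

Lemma tdespkGF : t%:S * despkGF = t%:S - 1 + expx (-1) * s%:S / denom.
Proof.
transitivity (t%:S - t%:S * (t^-1)%:S
              + t%:S * (t^-1)%:S * (expx (-1) * s%:S / denom)).
  by rewrite /despkGF; ring.
by rewrite constfps_tV mul1r.
Qed.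

Lemma constfps_t_unit : t%:S \is a GRing.unit.
Proof. by apply/unitrP; exists (t^-1)%:S; rewrite mulrC constfps_tV. Qed.

Lemma despkGF0 : despkGF 0%N = 1.
Proof.
rewrite -[LHS]/(1 - t^-1 + ((t^-1)%:S * expx (-1) * s%:S / denom) 0%N).
by rewrite quotient0 !mulfps0 expx0 mulr1 mulfK // subrK.
Qed.

Lemma dfps_despkGF : dfps despkGF
  = (despkGF - 1) * ((1 - t)%:S + t%:S * peakGF) + (peakGF - despkGF).
Proof.
(* Multiplying by [t] and by the square of [denom] clears all denominators. *)
apply: (mulrI constfps_t_unit); apply: (mulIr (unitrX 2 denom_unit)).
have -> : t%:S * dfps despkGF = dfps (t%:S * despkGF).
  by rewrite dfpsM dfpsC mul0r add0r.
rewrite tdespkGF dfpsD dfpsD dfpsN dfpsC -[1 in LHS]/(1%:S) dfpsC subrr add0r.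
rewrite dfps_quotient.
have PQ : peakGF * denom = s%:S * coshx s by rewrite divrK ?denom_unit.
have DQ : t%:S * despkGF * denom = (t%:S - 1) * denom + expx (-1) * s%:S.
  by rewrite tdespkGF mulrDl divrK ?denom_unit.
transitivity ((t%:S * despkGF * denom - t%:S * denom) *
    ((1 - t)%:S * denom + t%:S * (peakGF * denom))
    + (t%:S * (peakGF * denom) - t%:S * despkGF * denom) * denom); last by ring.
rewrite PQ DQ dfps_denom dfpsM dfpsC dfps_expx // /denom !constfpsN.
by rewrite constfpsD constfpsN -[1%:S]/(1 : fps L) constfps_t; ring.
Qed.

(** Expanding the fraction by cosh shows that the closed form for valleys is e^-x times the series
    of all permutations. *)
Lemma desvlGF_E :
  expx (-1) * s%:S / (s%:S - tanhx s) = expx (-1) * peakGF.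
Proof.
have cosh_unit : coshx s \is a GRing.unit.
  suff : coshx s 0%N \is a GRing.unit by [].
  by rewrite coshx0 // unitr1.
have denomE : denom = (s%:S - tanhx s) * coshx s.
  by rewrite mulrBl divrK.
have U : s%:S - tanhx s \is a GRing.unit.
  by have := denom_unit; rewrite denomE unitrM => /andP[].
rewrite -mulrA; congr (_ * _); apply: (mulIr denom_unit).
by rewrite [RHS]divrK ?denom_unit // denomE mulrA divrK.
Qed.

Lemma desvlGF0 : (expx (-1) * peakGF) 0%N = 1.
Proof. by rewrite mulfps0 expx0 peakGF0 mulr1. Qed.

(** The derivative of e^-x cancels the last summand [P] of [peakw_ode]. *)
Lemma dfps_desvlGF : dfps (expx (-1) * peakGF)
  = (expx (-1) * peakGF - expx (-1)) * ((1 - t)%:S + t%:S * peakGF).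
Proof.
rewrite dfpsM dfps_expx // peakGF_ode constfpsN -[1%:S]/(1 : fps L); ring.
Qed.

End ClosedForms.
End DesarrangementSeries.

Theorem theorem2p2 (L : fieldType)
    (iota : {rmorphism {fraction {poly rat}} -> L}) (t s : L)
    (ht : t = iota (tofrac 'X)) (hs : s ^+ 2 = 1 - t) :
  desGF pk t
    = 1 - (t^-1)%:S
      + (t^-1)%:S * expx (-1) * s%:S / (s%:S * coshx s - sinhx s)
  /\
  desGF vl t = expx (-1) * s%:S / (s%:S - tanhx s).
Proof.
(* [L] inherits characteristic zero from the rationals through [iota]. *)
have natL n : n.+1%:R != 0 :> L.
  rewrite -(rmorph_nat iota) fmorph_eq0 -(rmorph_nat (@tofrac {poly rat})).
  by rewrite tofrac_eq0 -polyC_natr polyC_eq0 Num.Theory.pnatr_eq0.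
have t_neq0 : t != 0 by rewrite ht fmorph_eq0 tofrac_eq0 polyX_eq0.
(* If [s] vanished, the polynomials 1 and ['X] would coincide; their constant coefficients
   differ. *)
have s_neq0 : s != 0.
  rewrite -sqrf_eq0 hs subr_eq0 ht -(rmorph1 iota) (inj_eq (fmorph_inj iota)).
  rewrite -(rmorph1 (@tofrac {poly rat})) tofrac_eq.
  apply/eqP => /polyP/(_ 0%N)/eqP.
  by rewrite coef1 coefX oner_eq0.
split.
  apply: (desGF_pk natL (peakGF0 natL s_neq0) (peakGF_ode natL hs s_neq0)).
    exact: despkGF0.
  exact: dfps_despkGF.
rewrite desvlGF_E //.
apply: (desGF_vl natL (peakGF0 natL s_neq0) (peakGF_ode natL hs s_neq0)).
  exact: desvlGF0.
exact: dfps_desvlGF.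
Qed.
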